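(* Let $X$ be a space which has a $\sigma$-strongly point-finite (respectively, $\sigma$-boundedly point-finite) family $\mathcal{P}$ of clopen sets such that $\mathcal{P}\cup\{X\setminus U: U\in\mathcal{P}\}$ is a subbase of $X$. Then $X$ can be embedded in a zero-dimensional Eberlein compact (respectively, a zero-dimensional uniform Eberlein compact). In particular, every space having a $\sigma$-strongly point-finite base of clopen sets can be embedded in a zero-dimensional Eberlein compact, and every space having a $\sigma$-boundedly point-finite or a $\sigma$-disjoint base of clopen sets can be embedded in a zero-dimensional uniform Eberlein compact.
   Context: ''Space'' means topological $T_0$-space. A family of subsets of a set is strongly point-finite if every countably infinite subfamily contains a finite subfamily with empty intersection; it is boundedly point-finite if there is an integer $n$ such that any $n+2$ of its members have empty intersection. $\sigma$-strongly point-finite (resp. $\sigma$-boundedly point-finite) means a countable union of strongly point-finite (resp. boundedly point-finite) families. An Eberlein compact is a compact Hausdorff space homeomorphic to a weakly compact subset of a Banach space; a uniform Eberlein compact is one homeomorphic to a weakly compact subset of a Hilbert space. *)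

(* Defs.v *)
From HB Require Import structures.
From mathcomp Require Import all_boot all_order all_algebra.
From mathcomp Require Import all_classical all_reals all_analysis.
Set Implicit Arguments. Unset Strict Implicit. Unset Printing Implicit Defensive.
Import Order.TTheory GRing.Theory Num.Theory.
Import numFieldNormedType.Exports.
Local Open Scope classical_set_scope.
Local Open Scope ring_scope.

Definition strongly_point_finite (T : Type) (F : set (set T)) : Prop :=
  forall g : nat -> set T, injective g -> (forall n, F (g n)) ->
    exists s : seq nat, forall x : T, exists2 i, i \in s & ~ g i x.

Definition boundedly_point_finite (T : Type) (F : set (set T)) : Prop :=
  exists n : nat, forall g : 'I_(n.+2) -> set T, injective g ->
    (forall i, F (g i)) -> forall x : T, exists i, ~ g i x.

Definition disjoint_family (T : Type) (F : set (set T)) : Prop :=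
  forall A B, F A -> F B -> A <> B -> A `&` B = set0.

Definition sigma_fam (T : Type) (Q : set (set T) -> Prop) (F : set (set T)) :=
  exists G : nat -> set (set T), (forall n, Q (G n)) /\ F = \bigcup_n G n.

Definition is_base (X : topologicalType) (B : set (set X)) : Prop :=
  (forall A, B A -> open A) /\
  forall (U : set X) (x : X), open U -> U x -> exists2 A, B A & (A x /\ A `<=` U).

Definition is_subbase (X : topologicalType) (S : set (set X)) : Prop :=
  (forall A, S A -> open A) /\
  forall (U : set X) (x : X), open U -> U x ->
    exists n (g : 'I_n -> set X), (forall i, S (g i)) /\ (forall i, g i x) /\
      (forall y, (forall i, g i y) -> U y).

Definition with_compl (X : Type) (P : set (set X)) : set (set X) :=
  P `|` [set A | exists2 U, P U & A = ~` U].

Section Weak.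
Variables (R : realType) (E : normedModType R).

Definition dual_elt (phi : E -> R) : Prop :=
  (forall (a : R) (x y : E), phi (a *: x + y) = a * phi x + phi y) /\
  continuous phi.

Definition weak_open (A : set E) : Prop :=
  forall x, A x -> exists n (phi : 'I_n -> E -> R) (e : R),
    [/\ 0 < e, (forall i, dual_elt (phi i)) &
        [set y | forall i, `|phi i y - phi i x| < e] `<=` A].

Definition weak_compact (K : set E) : Prop :=
  forall F : set (set E), (forall A, F A -> weak_open A) ->
    K `<=` \bigcup_(A in F) A ->
    exists n (g : 'I_n -> set E), (forall i, F (g i)) /\ K `<=` \bigcup_i g i.

Definition weak_hausdorff (K : set E) : Prop :=
  forall x y, K x -> K y -> x <> y ->
    exists U V, [/\ weak_open U, weak_open V, U x, V y & U `&` V = set0].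

Definition weak_rel_clopen (K C : set E) : Prop :=
  C `<=` K /\ (exists O, weak_open O /\ C = K `&` O) /\
  (exists O, weak_open O /\ K `\` C = K `&` O).

Definition weak_zero_dim (K : set E) : Prop :=
  forall x W, K x -> weak_open W -> W x ->
    exists C, [/\ weak_rel_clopen K C, C x & C `<=` W].

Definition weak_embedding (X : topologicalType) (f : X -> E) (K : set E) : Prop :=
  [/\ f @` setT `<=` K, injective f,
      (forall W, weak_open W -> open (f @^-1` W)) &
      (forall U : set X, open U ->
         exists W, weak_open W /\ f @` U = f @` setT `&` W)].

Definition zd_weakly_compact (K : set E) : Prop :=
  [/\ weak_compact K, weak_hausdorff K & weak_zero_dim K].
End Weak.

Definition hilbert_inner (R : realType) (E : normedModType R)
    (ip : E -> E -> R) : Prop :=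
  [/\ (forall (a : R) (x y z : E), ip (a *: x + y) z = a * ip x z + ip y z),
      (forall x y, ip x y = ip y x) &
      (forall x, ip x x = `|x| ^+ 2)].

Definition embeds_zd_eberlein (R : realType) (X : topologicalType) : Prop :=
  exists (E : completeNormedModType R) (K : set E) (f : X -> E),
    zd_weakly_compact K /\ weak_embedding f K.

Definition embeds_zd_uniform_eberlein (R : realType) (X : topologicalType) : Prop :=
  exists (E : completeNormedModType R) (ip : E -> E -> R),
    hilbert_inner ip /\
    exists (K : set E) (f : X -> E), zd_weakly_compact K /\ weak_embedding f K.

(* Main.v *)
(* X embeds in a Cantor cube by x |-> (1_U x)_(n,U), U ranging over the n-th
   subfamily. The closure of the image is compact, and each of its points
   selects from every subfamily a centered set of members: finitely many when
   the subfamily is strongly point-finite, at most a constant number when it is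
   boundedly point-finite. After weighting the n-th level by 2^-n (divided by
   that constant), the closure becomes a bounded set in c_0 or l_2. On it the
   weak topology is that of the cube, because a bounded functional is uniformly
   small on the vectors of the unit ball that vanish on a large enough finite
   set of coordinates. This last fact, as well as completeness, is proved for
   both spaces at once, using only finite-dimensional seminorms with
   nu_(F u G)^2 <= nu_F^2 + nu_G^2. *)
Require Import Defs.
From HB Require Import structures.
From mathcomp Require Import all_boot all_order all_algebra finmap.
From mathcomp Require Import all_classical all_reals all_analysis summability.
From mathcomp Require Import ring lra.
Set Implicit Arguments.
Unset Strict Implicit.
Unset Printing Implicit Defensive.
Import Order.TTheory GRing.Theory Num.Theory.
Import numFieldNormedType.Exports.
Local Open Scope classical_set_scope.
Local Open Scope fset_scope.
Local Open Scope ring_scope.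

(** * Banach spaces defined by seminorms on finite coordinate sets *)

(** [fsnU_sqr] is the upper 2-estimate common to sup and Euclidean norms; it later bounds a sum of m
    disjointly supported unit vectors by sqrt m. *)
Record fseminorm (R : realType) (I : choiceType) := FSeminorm {
  fsn :> {fset I} -> (I -> R) -> R;
  fsn_local : forall (F : {fset I}) (f g : I -> R),
    {in F, f =1 g} -> fsn F f = fsn F g;
  fsnD : forall F (f g : I -> R), fsn F (f + g) <= fsn F f + fsn F g;
  fsnZ : forall F (a : R) (f : I -> R), fsn F (a *: f) = `|a| * fsn F f;
  fsn_mono : forall F G f, F `<=` G -> fsn F f <= fsn G f;
  fsnU_sqr : forall F G f, fsn (F `|` G) f ^+ 2 <= fsn F f ^+ 2 + fsn G f ^+ 2;
  fsn1 : forall i f, fsn [fset i] f = `|f i| }.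

Section FSeminormTheory.
Context {R : realType} {I : choiceType} (N : fseminorm R I).
Implicit Types (F G : {fset I}) (f g : I -> R).

Lemma fsn0r F : N F 0 = 0.
Proof. by rewrite -[0 in LHS](scale0r (0 : I -> R)) fsnZ normr0 mul0r. Qed.

Lemma fsnN F f : N F (- f) = N F f.
Proof. by rewrite -scaleN1r fsnZ normrN1 mul1r. Qed.

Lemma fsn_ge0 F f : 0 <= N F f.
Proof.
have := fsnD N F f (- f).
by rewrite subrr fsn0r fsnN -mulr2n pmulrn_lge0.
Qed.

Lemma fsn_eq0 F f : {in F, forall i, f i = 0} -> N F f = 0.
Proof. by move=> f0; rewrite (@fsn_local _ _ N _ _ 0) ?fsn0r. Qed.

Lemma fsn_fset0 f : N fset0 f = 0.
Proof. by apply: fsn_eq0 => i; rewrite in_fset0. Qed.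

Lemma fsnU F G f : N (F `|` G) f <= N F f + N G f.
Proof.
rewrite -(@ler_pXn2r _ 2) ?nnegrE ?addr_ge0 ?fsn_ge0//.
apply: (le_trans (fsnU_sqr _ _ _ _)).
by have := fsn_ge0 F f; have := fsn_ge0 G f; nra.
Qed.

(** Lets coordinatewise convergence control each seminorm, and lets counting bound the seminorm of a
    0-1 vector. *)
Lemma le_fsn_sum F f : N F f <= \sum_(i <- F) `|f i|.
Proof.
elim/fset1U_rect: F => [|i F iF IH]; first by rewrite fsn_fset0 sumr_ge0.
by rewrite big_fsetU1//= -(@fsn1 _ _ N) (le_trans (fsnU _ _ _))// lerD2l.
Qed.

Lemma fsn_setID F G f : N F f <= N (F `&` G) f + N (F `\` G) f.
Proof. by rewrite -{1}(fsetID G F) fsnU. Qed.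

(* The span of the unit vectors is dense in this space: it is c_0 for the sup
   seminorms and l_2 for the Euclidean ones. *)
Definition tail_null : {pred I -> R} := fun f =>
  `[< forall e, 0 < e -> exists F, forall G, N (G `\` F) f <= e >].

Lemma tail_nullP f : reflect
  (forall e, 0 < e -> exists F, forall G, N (G `\` F) f <= e) (f \in tail_null).
Proof. exact: asboolP. Qed.

Lemma tail_null_submod : submod_closed tail_null.
Proof.
split; first by apply/tail_nullP => e e0; exists fset0 => G; rewrite fsn0r ltW.
move=> a f g /tail_nullP fN /tail_nullP gN; apply/tail_nullP => e e0.
have a0 : 0 < `|a| + 1 by rewrite ltr_wpDl.
have [F FP] := fN (e / 2 / (`|a| + 1)) ltac:(by rewrite !divr_gt0).
have [G GP] := gN (e / 2) ltac:(by rewrite divr_gt0).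
exists (F `|` G) => H; rewrite (le_trans (fsnD _ _ _ _))// fsnZ.
rewrite (splitr e) lerD//.
  rewrite (@le_trans _ _ (`|a| * N (H `\` F) f))//.
    by rewrite ler_wpM2l// fsn_mono// fsetDS// fsubsetUl.
  rewrite (@le_trans _ _ (`|a| * (e / 2 / (`|a| + 1))))// ?ler_wpM2l//.
  rewrite mulrCA ler_piMr// ?divr_ge0 ?(ltW e0)//.
  by rewrite ler_pdivrMr// mul1r lerDl.
by rewrite (le_trans _ (GP H))// fsn_mono// fsetDS// fsubsetUr.
Qed.

HB.instance Definition _ :=
  GRing.isSubmodClosed.Build R (I -> R) tail_null tail_null_submod.

Record space := Space { coords :> I -> R; coordsP : coords \in tail_null }.

HB.instance Definition _ := [isSub for coords].
HB.instance Definition _ := [Choice of space by <:].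
HB.instance Definition _ := [SubChoice_isSubLmodule of space by <:].

Implicit Types (x y : space).

Lemma space_ext x y : x =1 y -> x = y.
Proof. by move=> xy; apply: val_inj; apply/funext. Qed.

Lemma coordsD x y i : (x + y) i = x i + y i. Proof. by []. Qed.
Lemma coordsN x i : (- x) i = - x i. Proof. by []. Qed.
Lemma coordsZ a x i : (a *: x) i = a * x i. Proof. by []. Qed.

Definition space_norm x : R := sup [set N F x | F in setT].

(** Beyond a suitable [F] all tails are at most 1, so [N F x + 1] bounds every seminorm. *)
Lemma space_norm_has_sup x : has_sup [set N F x | F in setT].
Proof.
split; first by exists (N fset0 x); exists fset0.
have /tail_nullP/(_ 1 ltr01)[F FP] := coordsP x.
exists (N F x + 1) => _ [G _ <-].
rewrite (le_trans (fsn_setID G F x))// lerD//.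
by rewrite fsn_mono// fsubsetIr.
Qed.

Lemma fsn_le_norm F x : N F x <= space_norm x.
Proof. by apply: (sup_upper_bound (space_norm_has_sup x)); exists F. Qed.

Lemma space_norm_le x c : (forall F, N F x <= c) -> space_norm x <= c.
Proof.
move=> xc; apply: ge_sup; first by exists (N fset0 x); exists fset0.
by move=> _ [F _ <-].
Qed.

Lemma space_normD x y : space_norm (x + y) <= space_norm x + space_norm y.
Proof.
apply: space_norm_le => F.
by rewrite (le_trans (fsnD _ _ _ _))// lerD ?fsn_le_norm.
Qed.

Lemma space_normZ a x : space_norm (a *: x) = `|a| * space_norm x.
Proof.
have le b z : space_norm (b *: z) <= `|b| * space_norm z.
  by apply: space_norm_le => F; rewrite fsnZ ler_wpM2l// fsn_le_norm.
(* For nonzero [a] the reverse inequality is [le] for the inverse of [a] and the vector [a *: x]. *)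
apply/le_anti; rewrite le//=; have [->|a0] := eqVneq a 0.
  by rewrite normr0 mul0r (le_trans (fsn_ge0 fset0 (0 *: x)))// fsn_le_norm.
rewrite mulrC -ler_pdivlMr ?normr_gt0// mulrC -normfV.
by rewrite (le_trans _ (le _ _))// scalerA mulVf// scale1r.
Qed.

Lemma coord_le_norm x i : `|x i| <= space_norm x.
Proof. by rewrite -(@fsn1 _ _ N) fsn_le_norm. Qed.

Lemma space_norm_eq0 x : space_norm x = 0 -> x = 0.
Proof.
move=> x0; apply: space_ext => i; apply/normr0_eq0/le_anti.
by rewrite normr_ge0 andbT -x0 coord_le_norm.
Qed.

HB.instance Definition _ := @Lmodule_isNormed.Build R space space_norm
  space_normD space_normZ space_norm_eq0.

(** Coordinates are 1-Lipschitz, so the filter converges coordinatewise to some [h]. The bounds in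
    [h_dist] are uniform in [F], which yields both small tails of [h] and convergence in norm. *)
Lemma space_complete (H : set_system space) :
  ProperFilter H -> cauchy H -> cvg H.
Proof.
move=> PH /cauchyP cH.
have near_dist e : 0 < e -> exists x, \forall y \near H, `|x - y| <= e.
  move=> e0; have [x xH] := cH e e0; exists x.
  by apply: filterS xH => y; rewrite -ball_normE => /ltW.
have cvg_coord i : cvg ((fun x : space => x i) @ H).
  apply: cauchy_cvg; apply/cauchyP => e e0.
  have [x xH] := near_dist (e / 2) ltac:(by rewrite divr_gt0).
  exists (x i); apply: filterS xH => y /= xy; rewrite -ball_normE/=.
  rewrite (le_lt_trans (coord_le_norm (x - y) i))//.
  by rewrite (le_lt_trans xy)// gtr_pMr// invf_lt1// ltr1n.
pose h : I -> R := fun i => lim ((fun x : space => x i) @ H).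
have h_dist x e : 0 < e -> (\forall y \near H, `|x - y| <= e) ->
    forall F, N F ((x : I -> R) - h) <= e.
  move=> e0 xH F; apply/ler_addgt0Pr => d d0.
  (* The error [d] is shared among the coordinates of [F]; the added 1 covers the empty set. *)
  pose d' := d / (#|` F|%:R + 1).
  have d'0 : 0 < d' by rewrite divr_gt0// ltr_wpDl.
  have yH : H [set y : space | forall i, i \in F -> `|y i - h i| <= d'].
    apply: (filter_bigI (f := fun i => [set y : space | `|y i - h i| <= d'])).
    by move=> i _; move/cvgr_distC_le: (cvg_coord i) => /(_ _ d'0).
  have [y [/= xy yh]] := filter_ex (filterI xH yH).
  have -> : (x : I -> R) - h = (coords (x - y)) + ((y : I -> R) - h).
    by apply/funext => i; rewrite !fctE addrA subrK.
  rewrite (le_trans (fsnD _ _ _ _))// lerD//.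
    by rewrite (le_trans (fsn_le_norm _ _)).
  rewrite (le_trans (le_fsn_sum _ _))// (@le_trans _ _ (\sum_(i <- F) d'))//.
    by rewrite !big_seq; apply: ler_sum.
  rewrite big_const_seq count_predT iter_addr_0 -[_ *+ _]mulr_natr /d'.
  by rewrite mulrAC ler_pdivrMr ?ltr_wpDl// ler_pM2l// lerDl.
have hN : h \in tail_null.
  apply/tail_nullP => e e0.
  have e20 : 0 < e / 2 by rewrite divr_gt0.
  have [x xH] := near_dist _ e20.
  have /tail_nullP/(_ _ e20)[F FP] := coordsP x; exists F => G.
  have -> : h = (x : I -> R) - ((x : I -> R) - h).
    by apply/funext => i; rewrite !fctE opprB addrCA subrr addr0.
  rewrite (le_trans (fsnD _ _ _ _))// fsnN (splitr e) lerD//.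
  exact: h_dist.
apply/cvg_ex; exists (Space hN); apply/cvgrPdist_le => e e0.
have e20 : 0 < e / 2 by rewrite divr_gt0.
have [x xH] := near_dist _ e20.
apply: filterS (xH) => y xy.
have -> : Space hN - y = (x - y) - (x - Space hN).
  by rewrite opprB [RHS]addrC addrA subrK.
rewrite (le_trans (ler_normB _ _))// (splitr e) lerD//.
by apply: space_norm_le => F; apply: h_dist; last exact: xH.
Qed.

HB.instance Definition _ := Uniform_isComplete.Build space space_complete.

End FSeminormTheory.

(** * Bounded functionals *)

Section DualFunctionals.
Context {R : realType} {I : choiceType} (N : fseminorm R I).
Implicit Types (F G : {fset I}) (x y : space N).

Definition restr_fun F (f : I -> R) : I -> R :=
  fun i => if i \in F then f i else 0.

Lemma restr_tail_null F f : restr_fun F f \in tail_null N.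
Proof.
apply/tail_nullP => e e0; exists F => G.
by rewrite fsn_eq0 ?ltW// => i; rewrite inE /restr_fun => /andP[/negbTE ->].
Qed.

Definition restr F x : space N := Space (restr_tail_null F x).

Lemma fsn_restr F G x : N G (restr F x) <= N (G `&` F) x.
Proof.
rewrite (le_trans (fsn_setID N G F _))// [X in _ + X]fsn_eq0 ?addr0.
  rewrite (@fsn_local _ _ N _ _ (x : I -> R))// => i.
  by rewrite inE /= /restr_fun => /andP[_ ->].
by move=> i; rewrite inE /= /restr_fun => /andP[/negbTE ->].
Qed.

Lemma norm_restr F x : `|restr F x| <= `|x|.
Proof.
apply: space_norm_le => G.
by rewrite (le_trans (fsn_restr _ _ _))// fsn_le_norm.
Qed.

Lemma restr_approx x e : 0 < e -> exists F, `|x - restr F x| <= e.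
Proof.
move=> e0; have /tail_nullP/(_ _ e0)[F FP] := coordsP x; exists F.
apply: space_norm_le => G; apply: le_trans (FP G).
rewrite (le_trans (fsn_setID N G F _))// fsn_eq0 ?add0r => [|i].
  rewrite (@fsn_local _ _ N _ _ (x : I -> R))// => i.
  rewrite inE coordsD coordsN /= /restr_fun => /andP[/negbTE -> _].
  by rewrite subr0.
rewrite inE coordsD coordsN /= /restr_fun => /andP[_ ->].
by rewrite subrr.
Qed.

Lemma norm_sqr_le x c : (forall F, N F x ^+ 2 <= c) -> `|x| ^+ 2 <= c.
Proof.
move=> xc; have c0 : 0 <= c by rewrite (le_trans _ (xc fset0))// sqr_ge0.
rewrite -[leRHS]sqr_sqrtr// ler_pXn2r ?nnegrE ?sqrtr_ge0//.
apply: space_norm_le => F.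
by rewrite -(ger0_norm (fsn_ge0 N F x)) -sqrtr_sqr ler_wsqrtr.
Qed.

(** The part of a finite set inside [F] sees only [x], the part outside only [y]; [fsnU_sqr] adds
    the squares. *)
Lemma norm_sqrD_disjoint F x y : (forall i, i \notin F -> x i = 0) ->
  {in F, forall i, y i = 0} -> `|x + y| ^+ 2 <= `|x| ^+ 2 + `|y| ^+ 2.
Proof.
move=> x0 y0; apply: norm_sqr_le => G; rewrite -{1}(fsetID F G).
rewrite (le_trans (fsnU_sqr _ _ _ _))// lerD//.
  rewrite (@fsn_local _ _ N _ _ (x : I -> R)).
    by rewrite ler_pXn2r ?nnegrE ?fsn_ge0 ?fsn_le_norm.
  by move=> i; rewrite inE coordsD => /andP[_ iF]; rewrite y0 ?addr0.
rewrite (@fsn_local _ _ N _ _ (y : I -> R)).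
  by rewrite ler_pXn2r ?nnegrE ?fsn_ge0 ?fsn_le_norm.
by move=> i; rewrite inE coordsD => /andP[iF _]; rewrite x0 ?add0r.
Qed.

Variable phi : space N -> R.
Hypothesis dphi : dual_elt phi.

Lemma dualD x y : phi (x + y) = phi x + phi y.
Proof. by have := dphi.1 1 x y; rewrite scale1r mul1r. Qed.

Lemma dual0 : phi 0 = 0.
Proof. by apply: (@addrI _ (phi 0)); rewrite -dualD !addr0. Qed.

Lemma dualZ a x : phi (a *: x) = a * phi x.
Proof. by have := dphi.1 a x 0; rewrite dual0 !addr0. Qed.

Lemma dualN x : phi (- x) = - phi x.
Proof. by rewrite -scaleN1r dualZ mulN1r. Qed.

(** Continuity at 0 keeps [phi] below 1 on a ball of radius [d]; rescaling [x] to norm [d / 2] gives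
    the constant [2 / d]. *)
Lemma dual_bounded : exists2 C, 0 < C & forall x, `|phi x| <= C * `|x|.
Proof.
have /cvgrPdist_lt/(_ 1 ltr01)/nbhs_norm0P[d /= d0 dP] := dphi.2 0.
exists (2 / d) => [|x]; first by rewrite divr_gt0.
have [->|x0] := eqVneq x 0; first by rewrite dual0 !normr0 mulr0.
have nx : 0 < `|x| by rewrite normr_gt0.
pose k := d / 2 / `|x|; have k0 : 0 < k by rewrite !divr_gt0.
have /= := dP (k *: x); rewrite dual0 add0r normrN dualZ normrM normrZ.
rewrite !(gtr0_norm k0) {1}/k divfK ?gt_eqF// gtr_pMr// invf_lt1// ltr1n.
by move=> /(_ isT)/ltW; rewrite -ler_pdivlMl// mulr1 /k !invfM !invrK mulrC [d^-1 * _]mulrC mulrC.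
Qed.

(* Otherwise there are arbitrarily many disjointly supported vectors of norm at
   most 1 on which phi exceeds e / 2; the sum of m of them has norm at most
   sqrt m, while phi takes a value of at least m e / 2 there. *)
Lemma dual_tail e : 0 < e -> exists F, forall x,
  `|x| <= 1 -> {in F, forall i, x i = 0} -> `|phi x| <= e.
Proof.
move=> e0; apply: contrapT => notail.
have [C C0 phiC] := dual_bounded.
have block F : exists G x, [/\ forall i, i \notin G -> x i = 0, `|x| <= 1,
    {in F, forall i, x i = 0} & e / 2 <= phi x].
  have [x [x1 xF xe]] : exists x,
      [/\ `|x| <= 1, {in F, forall i, x i = 0} & e <= phi x].
    apply: contrapT => nox; apply: notail; exists F => x x1 xF.
    rewrite leNgt; apply/negP; have [_|_] := ger0P (phi x).
      by move=> ex; apply: nox; exists x; split => //; exact: ltW.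
    move=> /ltW ex; apply: nox; exists (- x); rewrite normrN dualN.
    by split=> // i iF; rewrite coordsN xF ?oppr0.
  (* Truncation makes the support finite, so that the next block can avoid it; this tolerance costs
     [phi] at most [e / 2]. *)
  have [G GP] := restr_approx x (ltac:(by rewrite divr_gt0// mulr_gt0) : 0 < e / (2 * C)).
  exists G, (restr G x); split.
  - by move=> i /negbTE iG; rewrite /= /restr_fun iG.
  - exact: le_trans (norm_restr _ _) _.
  - by move=> i iF; rewrite /= /restr_fun xF// if_same.
  - have : `|phi (x - restr G x)| <= e / 2.
      rewrite (le_trans (phiC _))// mulrC -ler_pdivlMr//.
      by rewrite (le_trans GP)// invfM mulrA.
    by rewrite dualD dualN ler_norml => /andP[_]; lra.
have sum m : exists G x, [/\ forall i, i \notin G -> x i = 0,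
    `|x| ^+ 2 <= m%:R & m%:R * (e / 2) <= phi x].
  elim: m => [|m [F [x [xF xm phix]]]].
    by exists fset0, 0; rewrite normr0 expr0n/= dual0 mul0r.
  have [G [y [yG y1 yF phiy]]] := block F.
  exists (F `|` G), (x + y); split.
  - by move=> i; rewrite inE negb_or => /andP[iF iG]; rewrite coordsD xF ?yG ?addr0.
  - rewrite (le_trans (norm_sqrD_disjoint xF yF))// -natr1 lerD//.
    by rewrite exprn_ile1.
  - by rewrite dualD -natr1 mulrDl mul1r lerD.
(* Squaring [m * (e / 2) <= C * sqrt m] gives [m <= c], so any [m] above [c] is contradictory. *)
pose c := C ^+ 2 / (e / 2) ^+ 2.
have e20 : 0 < e / 2 by rewrite divr_gt0.
have [m cm] : exists m : nat, c < m%:R.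
  by exists (Num.truncn c).+1; rewrite truncnS_gt.
have [G [x [_ xm phix]]] := sum m.
have m0 : 0 < m%:R :> R by rewrite (le_lt_trans _ cm)// divr_ge0 ?sqr_ge0.
have : (m%:R * (e / 2)) ^+ 2 <= C ^+ 2 * m%:R.
  rewrite (@le_trans _ _ ((C * `|x|) ^+ 2))//.
    rewrite ler_pXn2r ?nnegrE ?mulr_ge0 ?(ltW C0) ?(ltW m0) ?(ltW e0)//.
    by rewrite (le_trans phix)// (le_trans (ler_norm _)).
  by rewrite exprMn ler_wpM2l ?sqr_ge0.
rewrite exprMn [X in X * _]expr2 -mulrA [leRHS]mulrC ler_pM2l// -ler_pdivlMr ?exprn_gt0//.
by move=> /le_lt_trans/(_ cm); rewrite ltxx.
Qed.

End DualFunctionals.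

Lemma coord_dual (R : realType) (I : choiceType) (N : fseminorm R I) (i : I) :
  dual_elt (fun x : space N => x i).
Proof.
split=> [a x y|x]; first by rewrite coordsD coordsZ.
move=> U /nbhs_normP[e e0 eU]; apply/(@nbhs_normP R (space N) x).
exists e => // y /= xy; apply: eU.
exact: le_lt_trans (coord_le_norm (x - y) i) xy.
Qed.

(** * Embeddings of a cube in a Banach space with its weak topology *)

Lemma open_bigcap_fset (T : topologicalType) (I : choiceType) (F : {fset I})
    (f : I -> set T) : (forall i, i \in F -> open (f i)) ->
  open (\bigcap_(i in [set` F]) f i)%classic.
Proof.
move=> fo; rewrite openE => x fx; apply: filter_bigI => i iF.
by apply: open_nbhs_nbhs; split; [exact: fo|exact: fx].
Qed.

Definition cube (I : choiceType) : Type := prod_topology (fun _ : I => bool).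

HB.instance Definition _ (I : choiceType) := Pointed.on (cube I).
HB.instance Definition _ (I : choiceType) := Nbhs.on (cube I).
HB.instance Definition _ (I : choiceType) := Topological.on (cube I).

Section CubeEmbedding.
Context {R : realType} {I : choiceType} (N : fseminorm R I).
Context {X : topologicalType} (b : X -> I -> bool) (w : I -> R) (M : R).
Implicit Types (F G : {fset I}) (A B : I -> bool).

Definition weighted A : I -> R := fun i => w i *+ A i.

(** The default [0] is taken only when the weighted vector is not tail-null, hence never on
    [cube_closure] under [weighted_tail]. *)
Definition embed A : space N := insubd (0 : space N) (weighted A).

(* The closure of the range of b in the cube {0,1}^I. *)
Definition cube_closure : set (I -> bool) :=
  [set A : I -> bool | forall F, exists x, {in F, A =1 b x}].

Hypothesis w_gt0 : forall i, 0 < w i.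
Hypothesis weighted_tail : forall A, cube_closure A -> weighted A \in tail_null N.
Hypothesis weighted_le : forall A, cube_closure A -> forall F, N F (weighted A) <= M.

Lemma cube_closure_b x : cube_closure (b x).
Proof. by move=> F; exists x. Qed.

Lemma embedE A : cube_closure A -> embed A =1 weighted A.
Proof. by move=> /weighted_tail/(insubdK (0 : space N)) eA i; rewrite -[weighted A]eA. Qed.

Lemma norm_embed A : cube_closure A -> `|embed A| <= M.
Proof.
move=> cA; apply: space_norm_le => F.
rewrite (@fsn_local _ _ N _ _ (weighted A)) ?weighted_le// => i _.
exact: embedE.
Qed.

(** A coordinate of an embedded point is [0] or [w i], so a distance below [w i] excludes a change
    of value. *)
Lemma embed_sep A B i : cube_closure A -> cube_closure B ->
  `|embed A i - embed B i| < w i -> A i = B i.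
Proof.
move=> cA cB; rewrite !embedE// /weighted.
case: (A i); case: (B i) => //=; rewrite mulr1n mulr0n ?sub0r ?normrN ?subr0.
  all: by rewrite gtr0_norm// ltxx.
Qed.

Lemma weak_open_coord (W : set (space N)) :
  (forall x, W x -> exists F (e : R), 0 < e /\
     forall y : space N, {in F, forall i, `|y i - x i| < e} -> W y) ->
  weak_open W.
Proof.
move=> WP x /WP[F [e [e0 FW]]].
exists (size (enum_fset F)), (fun k (y : space N) => y (tnth (in_tuple (enum_fset F)) k)), e.
split => //= [k|y yx]; first exact: coord_dual.
apply: FW => i iF; have /tnthP[k ->] : i \in in_tuple (enum_fset F) by [].
exact: yx.
Qed.

Lemma small_min F (d : I -> R) : (forall i, 0 < d i) ->
  exists2 e, 0 < e & {in F, forall i, e <= d i}.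
Proof.
move=> d0; elim/fset1U_rect: F => [|i F _ [e e0 eF]]; first by exists 1.
exists (Num.min (d i) e) => [|j]; first by rewrite lt_min d0.
by rewrite !inE ge_min => /predU1P[->|/eF ->]; rewrite ?lexx ?orbT.
Qed.

(** The radius is half the gap between the two possible values of a coordinate, so on embedded
    points this set expresses agreement with [A] on [F]. *)
Definition cyl F A : set (space N) :=
  [set y : space N | {in F, forall i, `|y i - embed A i| < w i / 2}].

Lemma weak_open_cyl F A : weak_open (cyl F A).
Proof.
apply: weak_open_coord => x xA.
(* The slack left at [x]; the value 1 off [F] keeps [d] positive everywhere, as [small_min] asks. *)
pose d i := if i \in F then w i / 2 - `|x i - embed A i| else 1.
have [|e e0 eF] := @small_min F d.
  by move=> i; rewrite /d; case: ifPn => // /xA; rewrite subr_gt0.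
exists F, e; split => // y yx i iF.
have := eF i iF; rewrite /d iF; have := yx i iF.
have := ler_distD (x i) (y i) (embed A i); lra.
Qed.

(** On embedded points, where the distances are [0] or [w i], this open condition is the complement
    of [cyl F A]; it makes cylinders relatively clopen. *)
Lemma weak_open_cylC F A :
  weak_open [set y : space N | exists2 i, i \in F & `|y i - embed A i| > w i / 2].
Proof.
apply: weak_open_coord => x [i iF xi].
exists F, (`|x i - embed A i| - w i / 2); split; first by rewrite subr_gt0.
move=> y yx; exists i => //; have := yx i iF.
by have := ler_distD (y i) (x i) (embed A i); rewrite (distrC (x i) (y i)); lra.
Qed.

Lemma embed_cyl F A B : cube_closure A -> cube_closure B ->
  cyl F A (embed B) <-> {in F, A =1 B}.
Proof.
have w2 i : w i / 2 < w i by rewrite gtr_pMr// invf_lt1// ltr1n.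
move=> cA cB; split=> AB i iF; last by rewrite !embedE// /weighted AB// subrr normr0 divr_gt0.
by apply/esym/embed_sep => //; apply: lt_trans (AB i iF) _.
Qed.

Lemma cylC_embed F A B : cube_closure A -> cube_closure B ->
  (exists2 i, i \in F & `|embed B i - embed A i| > w i / 2) <->
  ~ {in F, A =1 B}.
Proof.
have w2 i : w i / 2 < w i by rewrite gtr_pMr// invf_lt1// ltr1n.
move=> cA cB; split=> [[i iF wi] AB|nAB].
  by move: wi; rewrite !embedE// /weighted AB// subrr normr0 ltNge divr_ge0// ltW.
apply: contrapT => nex; apply: nAB => i iF; apply/esym/embed_sep => //.
by apply: le_lt_trans (w2 i); rewrite leNgt; apply/negP => wi; apply: nex; exists i.
Qed.

(** On the image the weak topology is no finer than that of the cube: when [A] and [B] agree on a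
    large finite set, the difference of their images is bounded and vanishes there, so [dual_tail]
    makes the finitely many functionals small on it. *)
Lemma weak_open_embed (W : set (space N)) A :
  weak_open W -> cube_closure A -> W (embed A) ->
  exists F, forall B, cube_closure B -> {in F, A =1 B} -> W (embed B).
Proof.
move=> Wo cA /Wo[n [phi [e [e0 dphi phiW]]]].
(* This factor exceeds the distance between any two embedded points and is positive whatever [M] is;
   dividing by it brings differences into the unit ball. *)
have M1 : 0 < 2 * (`|M| + 1) by rewrite mulr_gt0// ltr_wpDl.
have tail k : exists F, forall x : space N,
    `|x| <= 1 -> {in F, forall i, x i = 0} -> `|phi k x| <= e / 2 / (2 * (`|M| + 1)).
  by apply: (dual_tail (dphi k)); rewrite !divr_gt0.
have [F FP] := choice tail.
exists (\bigcup_(k <- enum 'I_n) F k)%fset => B cB AB.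
apply: phiW => k /=.
pose x := (2 * (`|M| + 1))^-1 *: (embed B - embed A).
have x1 : `|x| <= 1.
  rewrite normrZ gtr0_norm ?invr_gt0// mulrC ler_pdivrMr// mul1r.
  rewrite (le_trans (ler_normB _ _))//.
  have := norm_embed cA; have := norm_embed cB; have := ler_norm M; lra.
have x0 : {in F k, forall i, x i = 0}.
  move=> i iF; rewrite coordsZ coordsD coordsN !embedE// /weighted AB ?subrr ?mulr0//.
  by apply/bigfcupP; exists k => //; rewrite mem_enum.
have := FP k x x1 x0.
rewrite /x (dualZ (dphi k)) (dualD (dphi k)) (dualN (dphi k)) normrM.
rewrite gtr0_norm ?invr_gt0// ler_pdivrMl// mulrC divfK ?gt_eqF//.
by move=> /le_lt_trans; apply; rewrite gtr_pMr// invf_lt1// ltr1n.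
Qed.

Lemma embed_inj A B : cube_closure A -> cube_closure B ->
  embed A = embed B -> A = B.
Proof.
move=> cA cB AB; apply/funext => i; apply: embed_sep => //.
by rewrite AB subrr normr0.
Qed.

Lemma open_agree F A : open ([set B | {in F, A =1 B}] : set (cube I)).
Proof.
have -> : [set B | {in F, A =1 B}] =
    (\bigcap_(i in [set` F]) [set B : (cube I) | B i = A i])%classic.
  by apply/seteqP; split => B /= AB i iF; rewrite AB.
apply: open_bigcap_fset => i _.
apply: (@open_comp (cube I) bool (fun B => B i) [set A i]) => [B _|].
  exact: (@proj_continuous I (fun=> bool)).
exact: discrete_open.
Qed.

(** A point outside matches no [b x] on some finite set, and the whole cylinder over that set misses
    the closure; Tychonoff's theorem gives compactness of the cube. *)
Lemma cube_closure_compact : compact (cube_closure : set (cube I)).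
Proof.
apply: (@subclosed_compact (cube I) _ setT) => //; last first.
  have := @tychonoff I (fun=> bool) (fun=> setT) (fun=> bool_compact).
  by congr (compact _); rewrite eqEsubset.
rewrite -openC openE => A /= nA.
have [F nF] : exists F, forall x, ~ {in F, A =1 b x}.
  apply: contrapT => nF; apply: nA => F; apply: contrapT => nx; apply: nF.
  by exists F => x Ax; apply: nx; exists x.
apply: (@filterS _ _ _ [set B : (cube I) | {in F, A =1 B}]).
  move=> B AB cB; have [x Bx] := cB F; apply: (nF x) => i iF.
  by rewrite AB// Bx.
by apply: open_nbhs_nbhs; split; [exact: open_agree|].
Qed.

Lemma embed_weak_compact : weak_compact (embed @` cube_closure)%classic.
Proof.
move=> S So Scov.
(* [embed] is controlled only on [cube_closure], so the preimage of [W] is replaced by the cylinders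
   whose points in the closure are sent into [W]. *)
pose g (W : set (space N)) : set (cube I) :=
  (\bigcup_(FA in [set FA : {fset I} * (cube I) | forall B, cube_closure B ->
      {in FA.1, FA.2 =1 B} -> W (embed B)]) [set B | {in FA.1, FA.2 =1 B}])%classic.
have := cube_closure_compact; rewrite compact_cover.
move=> /(_ _ S g)[W _|A cA|D DS Dcov].
- by apply: bigcup_open => FA _; exact: open_agree.
- have [|W SW WA] := Scov (embed A); first by exists A.
  exists W => //; have [F FP] := weak_open_embed (So _ SW) cA WA.
  by exists (F, A).
exists (size (enum_fset D)), (tnth (in_tuple (enum_fset D))); split.
  by move=> k; have := DS (tnth (in_tuple (enum_fset D)) k); rewrite mem_tnth inE; apply.
move=> _ [A cA <-]; have [W WD [[F B] FB /= BA]] := Dcov A cA.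
have /tnthP[k Wk] : W \in in_tuple (enum_fset D) by [].
by exists k => //; rewrite -Wk; apply: FB.
Qed.

(** Cylinders on a single coordinate separate points; cylinders on finite sets supply the clopen
    base. *)
Lemma embed_zd_weakly_compact : zd_weakly_compact (embed @` cube_closure)%classic.
Proof.
split; first exact: embed_weak_compact.
  move=> _ _ [A cA <-] [B cB <-] AB.
  have [i ABi] : exists i, A i <> B i.
    apply: contrapT => nAB; apply: AB; congr embed; apply/funext => i.
    by apply: contrapT => ABi; apply: nAB; exists i.
  exists (cyl [fset i] A), (cyl [fset i] B); split.
  - exact: weak_open_cyl.
  - exact: weak_open_cyl.
  - exact/embed_cyl.
  - exact/embed_cyl.
  - apply/seteqP; split => // y [/(_ i (fset11 i)) yA /(_ i (fset11 i)) yB].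
    apply: ABi; apply: embed_sep => //.
    have := ler_distD (y i) (embed A i) (embed B i).
    by rewrite (distrC (embed A i) (y i)); lra.
move=> _ W [A cA <-] Wo WA; have [F FP] := weak_open_embed Wo cA WA.
exists (embed @` [set B | cube_closure B /\ {in F, A =1 B}])%classic; split.
- split; first by move=> _ [B [cB _] <-]; exists B.
  split.
    exists (cyl F A); split; first exact: weak_open_cyl.
    apply/seteqP; split => [_ [B [cB AB] <-]|_ [[B cB <-]] /embed_cyl AB].
      by split; [exists B|apply/embed_cyl].
    by exists B => //; split=> //; exact: AB.
  exists [set y : space N | exists2 i, i \in F & `|y i - embed A i| > w i / 2].
  split; first exact: weak_open_cylC.
  apply/seteqP; split => [_ [[B cB <-] nAB]|_ [[B cB <-] /cylC_embed nAB]].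
    split; first by exists B.
    by apply/cylC_embed => // AB; apply: nAB; exists B.
  split; first by exists B.
  move=> [B' [cB' AB'] /embed_inj BB']; apply: nAB => //.
  by rewrite -BB'.
- by exists A.
- by move=> _ [B [cB AB] <-]; apply: FP.
Qed.

Hypothesis b_clopen : forall i, clopen [set x | b x i].
Hypothesis b_inj : injective b.
Hypothesis b_open : forall U x, open U -> U x ->
  exists F, forall y, {in F, b x =1 b y} -> U y.

Lemma open_agree_b F x : open [set y | {in F, b x =1 b y}].
Proof.
have -> : [set y | {in F, b x =1 b y}] =
    (\bigcap_(i in [set` F]) [set y | b y i = b x i])%classic.
  by apply/seteqP; split => y /= xy i iF; rewrite xy.
apply: open_bigcap_fset => i _; have [bo bc] := b_clopen i.
case: (b x i); first exact: bo.
have -> : [set y | b y i = false] = (~` [set y | b y i])%classic.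
  by apply/seteqP; split => y /=; [move=> ->|move/negP/negbTE].
by rewrite openC.
Qed.

Lemma embed_weak_embedding :
  weak_embedding (embed \o b) (embed @` cube_closure)%classic.
Proof.
have cb := cube_closure_b; split.
- by move=> _ [x _ <-]; exists (b x).
- by move=> x y /embed_inj xy; apply: b_inj; apply: xy.
- move=> W Wo; rewrite openE => x Wx.
  have [F FP] := weak_open_embed Wo (cb x) Wx.
  apply: (@filterS _ _ _ [set y | {in F, b x =1 b y}]).
    by move=> y xy; apply: FP.
  by apply: open_nbhs_nbhs; split; [exact: open_agree_b|].
(* The union of all cylinders that force membership in [U]; by [b_open] it contains the image of
   [U]. *)
- move=> U Uo; exists (\bigcup_(Fx in [set Fx : {fset I} * X |
    forall y, {in Fx.1, b Fx.2 =1 b y} -> U y]) cyl Fx.1 (b Fx.2))%classic.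
  split.
    move=> y [Fx FxU yFx]; have [n [phi [e [e0 dphi phiW]]]] := weak_open_cyl yFx.
    exists n, phi, e; split => // z /phiW zFx.
    by exists Fx.
  apply/seteqP; split => [_ [x Ux <-]|_ [[y _ <-] [Fx FxU /embed_cyl yFx]]].
    split; first by exists x.
    by have [F FP] := b_open Uo Ux; exists (F, x) => //=; apply/embed_cyl.
  by exists y => //; apply: FxU; apply: yFx.
Qed.

End CubeEmbedding.

(** * The spaces c_0 and l_2 *)

Section SupSeminorm.
Context (R : realType) (I : choiceType).
Implicit Types (F G : {fset I}) (f g : I -> R).

Definition sup_fsn F f : R := \big[Num.max/0]_(i <- F) `|f i|.

Lemma sup_fsn_ge0 F f : 0 <= sup_fsn F f.
Proof. exact: bigmax_ge_id. Qed.

Lemma sup_fsn_le F f c : 0 <= c -> {in F, forall i, `|f i| <= c} ->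
  sup_fsn F f <= c.
Proof.
by move=> c0 fc; rewrite /sup_fsn big_seq; apply: bigmax_le => // i /fc.
Qed.

Lemma le_sup_fsn F f i : i \in F -> `|f i| <= sup_fsn F f.
Proof. by move=> iF; exact: (le_bigmax_seq 0 i predT (fun j => `|f j|) iF isT). Qed.

Lemma sup_fsnD F f g : sup_fsn F (f + g) <= sup_fsn F f + sup_fsn F g.
Proof.
apply: sup_fsn_le => [|i iF]; first by rewrite addr_ge0 ?sup_fsn_ge0.
by rewrite (le_trans (ler_normD _ _))// lerD ?le_sup_fsn.
Qed.

Lemma sup_fsnZ F a f : sup_fsn F (a *: f) = `|a| * sup_fsn F f.
Proof.
rewrite /sup_fsn (big_morph _ (id1 := 0) (op1 := Num.max)
  (fun x y => maxr_pMr x y (normr_ge0 a))) ?mulr0//.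
by apply: eq_bigr => i _; rewrite normrM.
Qed.

Lemma sup_fsn_mono F G f : F `<=` G -> sup_fsn F f <= sup_fsn G f.
Proof.
move=> /fsubsetP FG; apply: sup_fsn_le => [|i /FG]; first exact: sup_fsn_ge0.
exact: le_sup_fsn.
Qed.

(** The left seminorm is at most the larger of the other two, whose square is one of the
    summands. *)
Lemma sup_fsnU_sqr F G f :
  sup_fsn (F `|` G) f ^+ 2 <= sup_fsn F f ^+ 2 + sup_fsn G f ^+ 2.
Proof.
have : sup_fsn (F `|` G) f <= Num.max (sup_fsn F f) (sup_fsn G f).
  apply: sup_fsn_le => [|i]; first by rewrite le_max sup_fsn_ge0.
  by rewrite inE le_max => /orP[] /(le_sup_fsn f) ->; rewrite ?orbT.
rewrite -(@ler_pXn2r _ 2) ?nnegrE ?le_max ?sup_fsn_ge0// => /le_trans; apply.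
by case: (leP (sup_fsn F f)) => _; [rewrite lerDr|rewrite lerDl]; exact: sqr_ge0.
Qed.

Definition sup_fseminorm : fseminorm R I.
Proof.
exists sup_fsn.
- by move=> F f g fg; rewrite /sup_fsn big_seq [RHS]big_seq; apply: eq_bigr => i /fg ->.
- exact: sup_fsnD.
- exact: sup_fsnZ.
- exact: sup_fsn_mono.
- exact: sup_fsnU_sqr.
- move=> i f; apply/le_anti; rewrite le_sup_fsn ?fset11// andbT.
  by apply: sup_fsn_le => // j /fset1P ->.
Defined.

End SupSeminorm.

Section L2Seminorm.
Context (R : realType) (I : choiceType).
Implicit Types (F G : {fset I}) (f g : I -> R).

Definition l2_fsn F f : R := Num.sqrt (\sum_(i <- F) f i ^+ 2).

Lemma sum_sqr_ge0 (s : seq I) f : 0 <= \sum_(i <- s) f i ^+ 2.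
Proof. by apply: sumr_ge0 => i _; rewrite sqr_ge0. Qed.

Lemma sqr_l2_fsn F f : l2_fsn F f ^+ 2 = \sum_(i <- F) f i ^+ 2.
Proof. by rewrite sqr_sqrtr ?sum_sqr_ge0. Qed.

(** Minkowski's inequality in the plane: after squaring it is Cauchy-Schwarz, which comes from the
    square of [a * t - b * s]. *)
Lemma sqrt_sqrD (a b s t : R) : 0 <= s -> 0 <= t ->
  Num.sqrt ((a + b) ^+ 2 + (s + t) ^+ 2) <=
  Num.sqrt (a ^+ 2 + s ^+ 2) + Num.sqrt (b ^+ 2 + t ^+ 2).
Proof.
move=> s0 t0; have p0 (u v : R) : 0 <= u ^+ 2 + v ^+ 2 by rewrite addr_ge0 ?sqr_ge0.
rewrite -(@ler_pXn2r _ 2) ?nnegrE ?addr_ge0 ?sqrtr_ge0//.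
rewrite sqr_sqrtr// [leRHS]sqrrD !sqr_sqrtr// -sqrtrM//.
have : a * b + s * t <= Num.sqrt ((a ^+ 2 + s ^+ 2) * (b ^+ 2 + t ^+ 2)).
  rewrite (le_trans (ler_norm _))// -sqrtr_sqr ler_wsqrtr//.
  by have := sqr_ge0 (a * t - b * s); nra.
lra.
Qed.

(** Induction on the list of coordinates: [sqrt_sqrD] combines the head entries with the norms of
    the rest. *)
Lemma l2_fsnD F f g : l2_fsn F (f + g) <= l2_fsn F f + l2_fsn F g.
Proof.
rewrite /l2_fsn; elim: (enum_fset F) => [|i s IH].
  by rewrite !big_nil sqrtr0 addr0.
rewrite !big_cons -[X in f i ^+ 2 + X]sqr_sqrtr ?sum_sqr_ge0//.
rewrite -[X in g i ^+ 2 + X]sqr_sqrtr ?sum_sqr_ge0//.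
apply: le_trans (sqrt_sqrD _ _ _ _); rewrite ?sqrtr_ge0// ler_wsqrtr//.
rewrite lerD2l -[leLHS]sqr_sqrtr ?sum_sqr_ge0//.
by rewrite ler_pXn2r ?nnegrE ?addr_ge0 ?sqrtr_ge0.
Qed.

Lemma l2_fsnZ F a f : l2_fsn F (a *: f) = `|a| * l2_fsn F f.
Proof.
rewrite /l2_fsn -sqrtr_sqr -sqrtrM ?sqr_ge0// mulr_sumr.
by congr Num.sqrt; apply: eq_bigr => i _; rewrite exprMn.
Qed.

Lemma sum_sqr_mono F G f : F `<=` G ->
  \sum_(i <- F) f i ^+ 2 <= \sum_(i <- G) f i ^+ 2.
Proof.
move=> FG; rewrite [leRHS](big_fsetID _ (mem F))/= -[leLHS]addr0 lerD ?sum_sqr_ge0//.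
rewrite le_eqVlt; apply/predU1l; congr (\sum_(i <- enum_fset _) _).
by apply/fsetP => i; rewrite !inE /= andbC; case: (boolP (i \in F)) => //= /(fsubsetP FG) ->.
Qed.

Lemma l2_fsnU_sqr F G f :
  l2_fsn (F `|` G) f ^+ 2 <= l2_fsn F f ^+ 2 + l2_fsn G f ^+ 2.
Proof.
rewrite !sqr_l2_fsn (big_fsetID _ (mem F))/= lerD//.
  by apply: sum_sqr_mono; apply/fsubsetP => i; rewrite !inE => /andP[].
apply: sum_sqr_mono; apply/fsubsetP => i; rewrite !inE /=.
by case/andP => /orP[->|].
Qed.

Definition l2_fseminorm : fseminorm R I.
Proof.
exists l2_fsn.
- move=> F f g fg; rewrite /l2_fsn; congr Num.sqrt.
  by rewrite big_seq [RHS]big_seq; apply: eq_bigr => i /fg ->.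
- exact: l2_fsnD.
- exact: l2_fsnZ.
- by move=> F G f FG; rewrite ler_wsqrtr// sum_sqr_mono.
- exact: l2_fsnU_sqr.
- by move=> i f; rewrite /l2_fsn big_seq_fset1 sqrtr_sqr.
Defined.

(** * The inner product of l_2 *)

Local Notation l2 := (space l2_fseminorm).
Implicit Types x y z : l2.

#[local] Existing Instance totally_filter.

(** The partial sums increase with [F] and, by [norm_sqr_le], come arbitrarily close to the squared
    norm. *)
Lemma l2_norm_cvg x :
  (fun F : {fset I} => \sum_(i <- F) x i ^+ 2) @ totally --> `|x| ^+ 2.
Proof.
have le_norm F : \sum_(i <- F) x i ^+ 2 <= `|x| ^+ 2.
  by rewrite -sqr_l2_fsn ler_pXn2r ?nnegrE ?sqrtr_ge0 ?(fsn_le_norm F x).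
apply/cvgrPdist_le => e e0.
have [F Fe] : exists F, `|x| ^+ 2 - e <= \sum_(i <- F) x i ^+ 2.
  apply: contrapT => nF; have : `|x| ^+ 2 <= `|x| ^+ 2 - e.
    apply: norm_sqr_le => F; rewrite [leLHS]sqr_l2_fsn leNgt; apply/negP => Fe.
    by apply: nF; exists F; rewrite ltW.
  by rewrite leNgt gtrBl e0.
exists F => // G /= FG; rewrite ger0_norm ?subr_ge0// lerBlDr -lerBlDl.
exact: le_trans Fe (sum_sqr_mono x FG).
Qed.

(** Polarization needs no summability and makes symmetry and the diagonal values immediate;
    linearity is read off the series in [l2_dot_cvg] by uniqueness of limits. *)
Definition l2_dot x y : R := (`|x + y| ^+ 2 - `|x - y| ^+ 2) / 4.

Lemma l2_dot_cvg x y :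
  (fun F : {fset I} => \sum_(i <- F) x i * y i) @ totally --> l2_dot x y.
Proof.
have -> : (fun F : {fset I} => \sum_(i <- F) x i * y i) =
    (fun F : {fset I} => (\sum_(i <- F) (x + y) i ^+ 2 -
               \sum_(i <- F) (x - y) i ^+ 2) / 4).
  apply/funext => F; rewrite -sumrB mulr_suml; apply: eq_bigr => i _.
  by rewrite !coordsD coordsN; field.
by apply: cvgMl; apply: cvgB; exact: l2_norm_cvg.
Qed.

Lemma l2_hilbert : hilbert_inner l2_dot.
Proof.
split=> [a x y z|x y|x].
- have cl := @l2_dot_cvg (a *: x + y) z.
  have cr : (fun F : {fset I} => \sum_(i <- F) (a *: x + y) i * z i) @ totally -->
      a * l2_dot x z + l2_dot y z.
    have -> : (fun F : {fset I} => \sum_(i <- F) (a *: x + y) i * z i) =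
        (fun F : {fset I} => a * (\sum_(i <- F) x i * z i) +
          \sum_(i <- F) y i * z i).
      apply/funext => F; rewrite mulr_sumr -big_split; apply: eq_bigr => i _ /=.
      by rewrite mulrDl mulrA.
    by apply: cvgD; [apply: cvgMr|]; exact: l2_dot_cvg.
  by rewrite -(cvg_lim (@Rhausdorff R) cl) (cvg_lim (@Rhausdorff R) cr).
- by rewrite /l2_dot (addrC y x) (distrC y x).
- by rewrite /l2_dot subrr normr0 expr0n/= subr0 -mulr2n normrMn; field.
Qed.

End L2Seminorm.

(** * Point-finite families *)

Section FamilyEmbedding.
Context {R : realType} {X : topologicalType}.
Context (G : nat -> set (set X)) (c : nat -> R).
Local Notation I := (nat * set X)%type.
Context (N : fseminorm R I).
Implicit Types (F : {fset I}) (A : I -> bool).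

(** Testing membership in [G] lets all pairs serve as indices: a pair outside the family is a
    constantly false coordinate. *)
Definition incidence (x : X) : I -> bool := fun i => `[< G i.1 i.2 /\ i.2 x >].

Definition level_weight (i : I) : R := 2^-1 ^+ i.1 / c i.1.

Local Notation K := (cube_closure incidence).

Lemma closure_family A n U : K A -> A (n, U) -> G n U.
Proof.
move=> /(_ [fset (n, U)])[x /(_ _ (fset11 _)) ->] /asboolP[].
by [].
Qed.

Lemma closure_centered A n (S : {fset set X}) : K A ->
  (forall U, U \in S -> A (n, U)) -> exists x, forall U, U \in S -> U x.
Proof.
move=> /(_ [fset (n, U) | U in S]%fset)[x Ax] SA; exists x => U US.
have := SA U US; rewrite Ax; first by case/asboolP.
by apply/imfsetP; exists U.
Qed.

Hypothesis c_gt0 : forall n, 0 < c n.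
Hypothesis level_finite : forall A n, K A ->
  exists S : {fset set X}, forall U, A (n, U) -> U \in S.
Hypothesis level_bound : forall A n F, K A -> {in F, forall i, i.1 = n} ->
  N F (fun i => (A i)%:R) <= c n.

Lemma level_weight_gt0 i : 0 < level_weight i.
Proof. by rewrite divr_gt0// exprn_gt0// invr_gt0. Qed.

Lemma fsn_level A n F : K A -> {in F, forall i, i.1 = n} ->
  N F (weighted level_weight A) <= 2^-1 ^+ n.
Proof.
move=> KA Fn; pose a : R := 2^-1 ^+ n / c n.
have a0 : 0 <= a by rewrite divr_ge0 ?exprn_ge0 ?invr_ge0// ltW.
rewrite (@fsn_local _ _ N _ _ (a *: (fun i => (A i)%:R : R))) => [|i iF].
  rewrite fsnZ ger0_norm// /a mulrAC ler_pdivrMr//.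
  by rewrite ler_wpM2l ?exprn_ge0 ?invr_ge0// level_bound.
by rewrite /weighted /level_weight Fn// fctE -[LHS]mulr_natr.
Qed.

(** A geometric series over the levels, each bounded by [fsn_level]. *)
Lemma fsn_levels A m F : K A -> {in F, forall i, (m <= i.1)%N} ->
  N F (weighted level_weight A) <= 2 * 2^-1 ^+ m.
Proof.
(* Induction on the number [k] of levels needs the exact geometric sum; dropping its negative term
   gives the claim. *)
move=> KA; suff fin k : forall F, {in F, forall i, (m <= i.1 < m + k)%N} ->
    N F (weighted level_weight A) <= 2 * (2^-1 ^+ m - 2^-1 ^+ (m + k)).
  move=> Fm; apply: (le_trans (fin (\max_(i <- F) i.1).+1 F _)).
    move=> i iF; rewrite Fm//= addnS ltnS (@leq_trans (\max_(i <- F) i.1))//.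
      exact: (leq_bigmax_seq (P := predT) (F := fun i : I => i.1)).
    exact: leq_addl.
  by rewrite ler_pM2l// gerBl exprn_ge0 ?invr_ge0.
elim: k => [|k IH] {}F Fm.
  rewrite addn0 subrr mulr0 fsn_eq0// => i /Fm.
  by rewrite addn0 ltnNge andbN.
pose L := [fset i in F | i.1 == (m + k)%N].
rewrite (le_trans (fsn_setID N F L _))//.
have -> : 2 * (2^-1 ^+ m - 2^-1 ^+ (m + k.+1)) =
    2^-1 ^+ (m + k) + 2 * (2^-1 ^+ m - 2^-1 ^+ (m + k)) :> R.
  by rewrite addnS exprS; field.
rewrite lerD//.
  by apply: fsn_level => // i; rewrite !inE => /andP[_ /andP[_ /eqP]].
apply: IH => i; rewrite !inE negb_and => /andP[/orP[/negP//|im] iF].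
by have /andP[->] := Fm i iF; rewrite addnS ltnS leq_eqVlt (negbTE im).
Qed.

Lemma level_weighted_le A : K A -> forall F, N F (weighted level_weight A) <= 2.
Proof.
by move=> KA F; rewrite (le_trans (fsn_levels (m := 0) KA _))// expr0 mulr1.
Qed.

(** Levels from [m] on contribute at most [e]. Below [m] each level has finitely many selected
    members; off these the vector vanishes. *)
Lemma level_weighted_tail A : K A -> weighted level_weight A \in tail_null N.
Proof.
move=> KA; apply/tail_nullP => e e0.
have [m me] : exists m, 2 * 2^-1 ^+ m <= e.
  have e20 : 0 < e / 2 by rewrite divr_gt0.
  have : (fun m => 2^-1 ^+ m : R) @ \oo --> (0 : R).
    by apply: cvg_expr; rewrite ger0_norm ?invr_ge0// invf_lt1// ltr1n.
  move=> /cvgr0_norm_le/(_ _ e20)[m _ /(_ m (leqnn m))].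
  rewrite ger0_norm ?exprn_ge0 ?invr_ge0// => me; exists m.
  by rewrite mulrC -ler_pdivlMr.
have [S SP] := choice (fun n => level_finite n KA).
exists (\bigcup_(n <- iota 0 m) [fset (n, U) | U in S n])%fset => F.
set F0 := (\bigcup_(n <- _) _)%fset.
rewrite (le_trans (fsn_setID N _ [fset i in F | (i.1 < m)%N] _))//.
rewrite fsn_eq0 ?add0r => [|[n U]].
  apply: le_trans me; apply: fsn_levels => // i.
  by rewrite !inE negb_and -leqNgt => /and3P[/orP[/negP nF|//] _ iF]; case: nF.
rewrite !inE /= => /andP[/andP[nF0 _] /andP[_ nm]].
rewrite /weighted; case: (boolP (A (n, U))) => //= AU; case/negP: nF0.
apply/bigfcupP; exists n; first by rewrite mem_iota add0n andbT.
by apply/imfsetP; exists U => //; exact: SP.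
Qed.

Hypothesis hT0 : kolmogorov_space X.
Hypothesis G_clopen : forall n U, G n U -> clopen U.
Hypothesis G_subbase : is_subbase (with_compl (\bigcup_n G n)%classic).

Lemma incidence_clopen i : clopen [set x | incidence x i].
Proof.
have [Gi|nGi] := pselect (G i.1 i.2).
  have -> : [set x | incidence x i] = i.2.
    by apply/seteqP; split=> x /=; [move/asboolP => []|move=> ?; apply/asboolP].
  exact: G_clopen Gi.
have -> : [set x | incidence x i] = set0.
  by apply/seteqP; split=> x //= /asboolP[].
by split; [exact: open0|exact: closed0].
Qed.

(** A coordinate decides membership in a set and in its complement alike, so one coordinate per
    subbasic set suffices. *)
Lemma incidence_open U x : open U -> U x ->
  exists F, forall y, {in F, incidence x =1 incidence y} -> U y.
Proof.
move=> Uo Ux; have [_ /(_ U x Uo Ux)[n [g [gS [gx gU]]]]] := G_subbase.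
have index k : exists i, forall y, incidence x i = incidence y i -> g k y.
  have [[m _ Gm]|[V [m _ GV] gV]] := gS k; have := gx k.
    exists (m, g k) => y /= xy.
    have : incidence x (m, g k) by apply/asboolP.
    by rewrite xy => /asboolP[].
  rewrite gV => nVx; exists (m, V) => y xy Vy; apply: nVx.
  have : incidence y (m, V) by apply/asboolP.
  by rewrite -xy => /asboolP[].
have [j jP] := choice index.
exists [fset j k | k in 'I_n]%fset => y xy; apply: gU => k.
by apply: jP; apply: xy; apply/imfsetP; exists k.
Qed.

(** By T_0 some neighbourhood of one point misses the other, and [incidence_open] detects it on
    finitely many coordinates. *)
Lemma incidence_inj : injective incidence.
Proof.
have sep x y (B : set X) : nbhs x B -> ~ B y -> incidence x <> incidence y.
  rewrite nbhsE => -[U [Uo Ux] UB] nBy xy; apply: nBy; apply: UB.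
  have [F FU] := incidence_open Uo Ux.
  by apply: FU => i _; rewrite xy.
move=> x y xy; apply/eqP/negP => /negP /hT0[B].
by case=> -[/set_mem Bx /set_mem By]; [exact: (sep x y B)|exact: (sep y x B)].
Qed.

Lemma family_embedding : exists (K : set (space N)) (f : X -> space N),
  zd_weakly_compact K /\ weak_embedding f K.
Proof.
exists (embed N level_weight @` K)%classic, (embed N level_weight \o incidence).
split.
  apply: embed_zd_weakly_compact level_weight_gt0 level_weighted_tail _.
  exact: level_weighted_le.
apply: embed_weak_embedding level_weight_gt0 level_weighted_tail _ _ _ _.
- exact: level_weighted_le.
- exact: incidence_clopen.
- exact: incidence_inj.
- exact: incidence_open.
Qed.

End FamilyEmbedding.

(** * Finiteness of the selection on each level *)

Section PointFinite.
Context {X : topologicalType} (G : nat -> set (set X)).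
Local Notation K := (cube_closure (incidence G)).

(** An infinite selection contains an injective sequence, whose finite subfamily with empty
    intersection contradicts [closure_centered]. *)
Lemma strongly_level_finite A n : strongly_point_finite (G n) -> K A ->
  exists S : {fset set X}, forall U, A (n, U) -> U \in S.
Proof.
move=> sG KA; have [/finite_fsetP[S AS]|] := pselect (finite_set [set U | A (n, U)]).
  by exists S => U AU; have : [set U | A (n, U)] U by []; rewrite AS.
move=> /infiniteP/pcard_leP[g].
have gA k : A (n, g k) by have := @funS _ _ _ _ g k I.
have g_inj : injective g by move=> k l; apply: inj; rewrite inE.
have [s sP] := sG g g_inj (fun k => closure_family KA (gA k)).
have [|x xP] := closure_centered (n := n) (S := [fset g k | k in s]%fset) KA.
  by move=> U /imfsetP[k _ ->].
have [k ks] := sP x; case; apply: xP.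
by apply/imfsetP; exists k.
Qed.

Lemma boundedly_strongly (F : set (set X)) :
  boundedly_point_finite F -> strongly_point_finite F.
Proof.
move=> [n nP] g g_inj gF; exists (iota 0 n.+2) => x.
have [i gi] := nP (g \o val) (inj_comp g_inj val_inj) (fun i => gF i) x.
by exists (val i) => //; rewrite mem_iota add0n ltn_ord.
Qed.

Lemma disjoint_boundedly (F : set (set X)) :
  disjoint_family F -> boundedly_point_finite F.
Proof.
(* With [0] the index type is ['I_2], whose two elements are [ord0] and [ord_max]. *)
move=> dF; exists 0 => g g_inj gF x; apply: contrapT => nx.
have gx i : g i x by apply: contrapT => ngx; apply: nx; exists i.
have g01 : g ord0 <> g ord_max by move=> /g_inj.
have : (g ord0 `&` g ord_max)%classic x by split.
by rewrite dF.
Qed.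

(** Some [x] matches [A] on [F] and so lies in every member listed there; [k + 2] such members are
    impossible. *)
Lemma level_card_bounded A n k (F : {fset nat * set X}) :
  (forall g : 'I_k.+2 -> set X, injective g -> (forall i, G n (g i)) ->
    forall x, exists i, ~ g i x) ->
  K A -> {in F, forall i, i.1 = n} -> {in F, forall i, A i} ->
  (#|` F| <= k.+1)%N.
Proof.
move=> kP KA Fn FA; rewrite leqNgt; apply/negP => Fk.
pose j (l : 'I_k.+2) := nth (n, set0) F l.
have jF l : j l \in F by rewrite mem_nth// (leq_trans _ Fk).
pose g l := (j l).2.
have jE l : j l = (n, g l) by rewrite -(Fn _ (jF l)) -surjective_pairing.
have gA l : A (n, g l) by rewrite -jE FA.
have g_inj : injective g.
  move=> l l' gl; have : j l = j l' by rewrite !jE gl.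
  move/eqP; rewrite nth_uniq ?fset_uniq ?(leq_trans _ Fk)//.
  by move/eqP/val_inj.
have [x xP] := KA F.
have [l []] := kP g g_inj (fun l => closure_family KA (gA l)) x.
by have := FA _ (jF l); rewrite xP// jE => /asboolP[].
Qed.

End PointFinite.

(** * Eberlein and uniform Eberlein embeddings *)

Section Embeddings.
Context (R : realType) (X : topologicalType) (hT0 : kolmogorov_space X).
Implicit Type P : set (set X).

Lemma strongly_eberlein P : (forall U, P U -> clopen U) ->
  sigma_fam (@strongly_point_finite X) P -> is_subbase (with_compl P) ->
  embeds_zd_eberlein R X.
Proof.
move=> Pc [G [sG PG]] PS; exists (space (sup_fseminorm R (nat * set X)%type)).
(* The sup norm of a 0-1 vector is at most 1, so the constant [1] serves on every level. *)
apply: (@family_embedding R X G (fun=> 1)) => //.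
- by move=> A n KA; exact: strongly_level_finite (sG n) KA.
- move=> A n F KA _; apply: sup_fsn_le => // i _.
  by rewrite normr_nat; case: (A i).
- by move=> n U GU; apply: Pc; rewrite PG; exists n.
- by rewrite -PG.
Qed.

Lemma boundedly_uniform_eberlein P : (forall U, P U -> clopen U) ->
  sigma_fam (@boundedly_point_finite X) P -> is_subbase (with_compl P) ->
  embeds_zd_uniform_eberlein R X.
Proof.
move=> Pc [G [bG PG]] PS; have [k kP] := choice bG.
exists (space (l2_fseminorm R (nat * set X)%type)), (@l2_dot R _); split.
  exact: l2_hilbert.
(* At most [k n + 1] members are selected on level [n], and their number bounds the l_2 norm of the
   indicator. *)
apply: (@family_embedding R X G (fun n => (k n).+1%:R)) => //.
- by move=> A n KA; apply: strongly_level_finite KA; apply: boundedly_strongly.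
- move=> A n F KA Fn; rewrite (le_trans (le_fsn_sum _ _ _))//.
  rewrite (eq_bigr (fun i => if A i then 1 else 0)) => [|i _]; last first.
    by rewrite normr_nat; case: (A i).
  rewrite -big_mkcond /= big_fset_condE big_const_seq count_predT iter_addr_0 ler_nat.
  apply: (level_card_bounded (kP n) KA) => i; rewrite !inE => /andP[iF Ai] //.
  exact: Fn.
- by move=> n U GU; apply: Pc; rewrite PG; exists n.
- by rewrite -PG.
Qed.

Lemma base_subbase P : (forall U, P U -> clopen U) -> is_base P ->
  is_subbase (with_compl P).
Proof.
move=> Pc [Po PB]; split=> [A [/Po//|[U /Pc[_ Uc] ->]]|U x Uo Ux].
  by rewrite openC.
have [A PA [Ax AU]] := PB U x Uo Ux.
exists 1%N, (fun=> A); split; first by left.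
by split=> // y /(_ ord0)/AU.
Qed.

End Embeddings.

Theorem theorem5p4 (R : realType) (X : topologicalType)
    (hT0 : @kolmogorov_space X) :
  [/\ (forall P : set (set X),
         (forall U, P U -> clopen U) ->
         sigma_fam (@strongly_point_finite X) P ->
         is_subbase (with_compl P) ->
         embeds_zd_eberlein R X),
      (forall P : set (set X),
         (forall U, P U -> clopen U) ->
         sigma_fam (@boundedly_point_finite X) P ->
         is_subbase (with_compl P) ->
         embeds_zd_uniform_eberlein R X),
      (forall B : set (set X),
         (forall U, B U -> clopen U) ->
         sigma_fam (@strongly_point_finite X) B ->
         is_base B ->
         embeds_zd_eberlein R X) &
      (forall B : set (set X),
         (forall U, B U -> clopen U) ->
         (sigma_fam (@boundedly_point_finite X) B \/
          sigma_fam (@disjoint_family X) B) ->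
         is_base B ->
         embeds_zd_uniform_eberlein R X)].
Proof.
split.
- exact: strongly_eberlein.
- exact: boundedly_uniform_eberlein.
- move=> B Bc sB /(base_subbase Bc); exact: strongly_eberlein.
- move=> B Bc bB /(base_subbase Bc); apply: boundedly_uniform_eberlein => //.
  case: bB => // -[G [dG ->]]; exists G; split => // n.
  exact: disjoint_boundedly.
Qed.
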